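(* (Generalized Fano's inequality.) Let $(P_\theta)_{\theta\in\Theta}$ be a statistical model, $\mathcal{A}$ an action space, and $\mathcal{L}$ a class of measurable loss functions $L:\Theta\times\mathcal{A}\to[0,\infty)$. Let $M\ge2$ be an integer, and let $\theta_1,\dots,\theta_M\in\Theta$ and $L_1,\dots,L_M\in\mathcal{L}$. Assume that there exist a (measurable) subset $\mathcal{A}_0\subseteq\mathcal{A}$ and $\Delta>0$ such that $$\inf_{a\in\mathcal{A}_0}\big[L_i(\theta_i,a)+L_j(\theta_j,a)\big]\ge\Delta\qquad\text{for all } i,j\in[M],\ i\ne j,$$ and that an estimator $a(X)$ satisfies $P_{\theta_i}(a(X)\in\mathcal{A}_0)\ge p_{\min}>0$ for all $i\in[M]$. Then for this estimator $$\sup_{\theta\in\Theta}\sup_{L\in\mathcal{L}}\mathbb{E}_\theta[L(\theta,a(X))]\ \ge\ \frac{\Delta}{2}\left(p_{\min}-\frac{I(U;X)+p_{\min}\log2}{\log M}\right),$$ where $I(U;X)$ is the mutual information between $U\sim\mathrm{Uniform}([M])$ and $X$ with conditional law $X\mid U\sim P_{\theta_U}$.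
   Context: Decision-theoretic setup: the learner observes $X\sim P_\theta$ with unknown $\theta\in\Theta$ and maps $X$ to a (possibly random) action $a(X)\in\mathcal{A}$; such a map is called an estimator. $\mathbb{E}_\theta$ is expectation under $X\sim P_\theta$ (and any additional randomness of $a$). $[M]=\{1,\dots,M\}$. Mutual information is $I(X;Y)=\int dP_{XY}\log\big(dP_{XY}/(dP_X\otimes dP_Y)\big)$, with $\log$ the natural logarithm. *)

(* Defs.v *)
From HB Require Import structures.
From mathcomp Require Import all_boot all_order all_algebra.
From mathcomp Require Import all_classical all_reals all_analysis.

Set Implicit Arguments.
Unset Strict Implicit.
Unset Printing Implicit Defensive.
Import Order.TTheory GRing.Theory Num.Theory.
Import numFieldNormedType.Exports.
Local Open Scope classical_set_scope.
Local Open Scope ring_scope.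

(* Finite label sets carry the discrete sigma-algebra.  A [measurableType] is
   pointed, hence 'I_n.+1 rather than 'I_n. *)
HB.instance Definition _ (n : nat) := isPointed.Build 'I_n.+1 ord0.

HB.instance Definition _ (n : nat) :=
  @isMeasurable.Build default_measure_display 'I_n.+1
    (@discrete_measurable 'I_n.+1) (@discrete_measurable0 'I_n.+1)
    (@discrete_measurableC 'I_n.+1) (@discrete_measurableU 'I_n.+1).

Section projections.
Context d1 d2 (T1 : measurableType d1) (T2 : measurableType d2).

HB.instance Definition _ := isMeasurableFun.Build _ _ (T1 * T2)%type T1
  (@fst T1 T2) (@measurable_fst _ _ T1 T2).

HB.instance Definition _ := isMeasurableFun.Build _ _ (T1 * T2)%type T2
  (@snd T1 T2) (@measurable_snd _ _ T1 T2).

End projections.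

Section information.
Local Open Scope ereal_scope.
Local Open Scope charge_scope.

(* Integral of [log (dP/dQ)] against P, with natural logarithm.  The library's
   Radon-Nikodym derivative only makes sense for P << Q; otherwise the usual
   convention +oo applies. *)
Definition relative_entropy d (T : measurableType d) (R : realType)
    (P Q : probability T R) : \bar R :=
  if `[< P `<< Q >]
  then \int[P]_x lne (('d (charge_of_finite_measure P) '/d Q) x)
  else +oo.

(* I(X;Y) as a function of the joint law P_XY; its marginals are the laws of
   the two projections. *)
Definition mutual_information d1 d2 (T1 : measurableType d1)
    (T2 : measurableType d2) (R : realType)
    (PXY : probability (T1 * T2)%type R) : \bar R :=
  relative_entropy PXY (distribution PXY fst \x distribution PXY snd).

End information.

(* Joint law of (U, X), where U is uniform on 'I_n.+1 and X | U = i has law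
   Q i. *)
Section uniform_joint_law.
Local Open Scope ereal_scope.
Context d (T : measurableType d) (R : realType) (n : nat).
Variable Q : 'I_n.+1 -> probability T R.

Definition uniform_joint_law (B : set ('I_n.+1 * T)) : \bar R :=
  \sum_(i < n.+1) (n.+1%:R^-1)%:E * Q i (xsection B i).

Let invn_ge0 : 0 <= (n.+1%:R^-1)%:E :> \bar R.
Proof. by rewrite lee_fin invr_ge0. Qed.

Let uniform_joint_law0 : uniform_joint_law set0 = 0.
Proof.
by rewrite /uniform_joint_law big1// => i _; rewrite xsection0 measure0 mule0.
Qed.

Let uniform_joint_law_ge0 B : 0 <= uniform_joint_law B.
Proof. by apply: sume_ge0 => i _; exact: mule_ge0. Qed.

Let uniform_joint_law_sigma_additive : semi_sigma_additive uniform_joint_law.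
Proof.
move=> F mF tF mUF; rewrite [X in _ --> X](_ : _ =
    lim ((fun k => \sum_(0 <= j < k) uniform_joint_law (F j)) @ \oo)).
  by apply: is_cvg_ereal_nneg_natsum => k _; exact: uniform_joint_law_ge0.
rewrite nneseries_sum//; last by move=> i j _; exact: mule_ge0.
apply: eq_bigr => /= i _.
rewrite nneseriesZl//; congr (_ * _).
rewrite xsection_bigcup.
apply/esym/cvg_lim => //; apply: measure_semi_sigma_additive.
- by move=> j; exact: measurable_xsection.
- exact: trivIset_xsection.
- by rewrite -xsection_bigcup; exact: measurable_xsection.
Qed.

HB.instance Definition _ := isMeasure.Build _ ('I_n.+1 * T)%type R
  uniform_joint_law uniform_joint_law0 uniform_joint_law_ge0
  uniform_joint_law_sigma_additive.

Let uniform_joint_law_setT : uniform_joint_law setT = 1.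
Proof.
rewrite /uniform_joint_law.
under eq_bigr do rewrite xsectionE preimage_setT probability_setT mule1.
by rewrite sumEFin sumr_const card_ord -[X in X%:E]mulr_natr mulVf// pnatr_eq0.
Qed.

HB.instance Definition _ := Measure_isProbability.Build _ ('I_n.+1 * T)%type R
  uniform_joint_law uniform_joint_law_setT.

Lemma uniform_joint_lawE i (B : set T) :
  uniform_joint_law ([set i] `*` B) = (n.+1%:R^-1)%:E * Q i B.
Proof.
rewrite /uniform_joint_law (bigD1 i)//= in_xsectionX ?inE// big1 ?adde0//.
move=> j ji; rewrite notin_xsectionX ?measure0 ?mule0//.
by apply/negP; rewrite inE => /eqP; exact/negP.
Qed.

End uniform_joint_law.

Section decision.
Local Open Scope ereal_scope.
Context dX dA (X : measurableType dX) (A : measurableType dA) (R : realType).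
Context (Theta : Type) (P : Theta -> probability X R).

(* Theta carries no sigma-algebra, so measurability of a loss means
   measurability in the action for each parameter. *)
Definition is_loss (L : Theta -> A -> R) :=
  (forall t a, (0 <= L t a)%R) /\ forall t, measurable_fun [set: A] (L t).

(* A randomized estimator is a probability kernel: [a x] is the conditional law
   of the action a(X) given X = x (Dirac for a deterministic estimator). *)
Variable a : R.-pker X ~> A.

Definition action_prob (t : Theta) (B : set A) : \bar R :=
  \int[P t]_x a x B.

Definition risk (L : Theta -> A -> R) (t : Theta) : \bar R :=
  \int[P t]_x \int[a x]_b (L t b)%:E.

End decision.

(* Main.v *)
(* Let [B_i] be the event that the action lies in [A0] and has loss
   [L_i(theta_i, .) < Delta / 2]; by separation the [B_i] are disjoint.  Write
   [r] for the probability that the action lies in [A0] and [s] for the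
   probability of [B_U], both under the joint law of (U, X).  Outside [B_U] an
   action in [A0] loses at least [Delta / 2], so the average risk is at least
   [Delta / 2 * (r - s)].  Under the product of the marginals, [B_U] has
   probability at most [r / M] while [A0] keeps probability [r]; the
   Donsker-Varadhan bound with the test function equal to [log (M / 2)] on
   [B_U], [- log 2] on the rest of [A0] and [0] elsewhere then gives
   [I(U; X) >= s * log M - r * log 2].  The randomness of the action is averaged
   out pointwise in (U, X), by concavity of the logarithm. *)
Require Import Defs.
From HB Require Import structures.
From mathcomp Require Import all_boot all_order all_algebra.
From mathcomp Require Import all_classical all_reals all_analysis.
From mathcomp Require Import measurable_realfun ring lra.
Set Implicit Arguments.
Unset Strict Implicit.
Unset Printing Implicit Defensive.
Import Order.TTheory GRing.Theory Num.Theory.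
Import numFieldNormedType.Exports.
Local Open Scope classical_set_scope.
Local Open Scope ring_scope.

(** * Preliminaries on logarithms and extended integrals *)

Lemma ln_le_subr1 (R : realType) (x : R) : 0 < x -> ln x <= x - 1.
Proof.
move=> x0; rewrite -[in X in X <= _](subrKC 1 x) le_ln1Dx//.
by rewrite ltrBDr addrC subrr.
Qed.

Lemma measurable_lne (R : realType) d (T : measurableType d) (f : T -> R) :
  measurable_fun setT f -> measurable_fun setT (fun x => lne (f x)%:E).
Proof.
move=> mf /=; apply: measurable_fun_ifT => //.
- exact: measurable_fun_ler.
- apply/measurable_EFinP; exact: measurableT_comp.
Qed.

(** Positive and negative parts are compared separately, so infinite integrals are allowed; the
    logarithm of a density may have one. *)
Lemma ae_ge_integral (R : realType) d (T : measurableType d)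
    (mu : {measure set T -> \bar R}) (f g : T -> \bar R) :
    measurable_fun setT f -> measurable_fun setT g ->
    {ae mu, forall x, f x <= g x}%E ->
  (\int[mu]_x f x <= \int[mu]_x g x)%E.
Proof.
move=> mf mg fg; rewrite integralE [leRHS]integralE; apply: leeB.
- apply: ae_ge0_le_integral => //; [exact: measurable_funepos..|].
  apply: filterS fg => x fgx _.
  by apply: (@funepos_le _ _ [set x]); rewrite ?inE// => y /[!inE] ->.
- apply: ae_ge0_le_integral => //; [exact: measurable_funeneg..|].
  apply: filterS fg => x fgx _.
  by apply: (@funeneg_le _ _ [set x]); rewrite ?inE// => y /[!inE] ->.
Qed.

(** * Densities and the Donsker-Varadhan bound *)

(** The derivative of a charge is pinned down only almost everywhere; a version that is finite and
    nonnegative everywhere permits real arithmetic at each point. *)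
Lemma Radon_Nikodym_nonneg_version (R : realType) d (T : measurableType d)
    (P Q : probability T R) : P `<< Q ->
  exists h : T -> R, [/\ measurable_fun setT h, forall x, 0 <= h x,
    {ae P, forall x,
      Radon_Nikodym (charge_of_finite_measure P) Q x = (h x)%:E},
    {ae P, forall x, 0 < h x} &
    forall f : T -> R, measurable_fun setT f -> (forall x, 0 <= f x) ->
      (\int[P]_x (f x)%:E = \int[Q]_x (f x * h x)%:E)%E].
Proof.
move=> PQ; pose p := Radon_Nikodym_SigmaFinite.f P Q.
have p0 x : (0 <= p x)%E by exact: Radon_Nikodym_SigmaFinite.f_ge0.
have pfin x : p x \is a fin_num by exact: Radon_Nikodym_SigmaFinite.f_fin_num.
have mp : measurable_fun setT p.
  exact: measurable_int (Radon_Nikodym_SigmaFinite.f_integrable _).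
have mh : measurable_fun setT (fine \o p) by exact: measurableT_comp.
have Pint (f : T -> R) : measurable_fun setT f -> (forall x, 0 <= f x) ->
    (\int[P]_x (f x)%:E = \int[Q]_x (f x * (fine \o p) x)%:E)%E.
  move=> mf f0.
  rewrite -(Radon_Nikodym_SigmaFinite.change_of_variables PQ)//; last first.
    exact/measurable_EFinP.
  by apply: eq_integral => x _; rewrite EFinM /= fineK.
exists (fine \o p); split=> //.
- by move=> x; exact: fine_ge0.
- have /(null_dominates_ae_eq measurableT PQ) :=
    ae_eq_Radon_Nikodym_SigmaFinite PQ measurableT.
  by apply: filterS => x /(_ I) <-; rewrite /= fineK.
(* The zero set of the density is P-null, because its P-measure is the Q-integral of the density
   over that set. *)
- pose N := (fine \o p) @^-1` [set 0].
  have mN : measurable N by rewrite -[N]setTI; apply: mh.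
  exists N; split => //.
    rewrite -(setIT N) -integral_indic// Pint//.
    apply: integral0_eq => x _; rewrite indicE; case: (boolP (x \in N)) => xN.
      by move: xN; rewrite inE => ->; rewrite mulr0.
    by rewrite mul0r.
  move=> x /= /negP; rewrite -leNgt => hx.
  by apply/eqP; rewrite eq_le hx fine_ge0.
Qed.

(* Pointwise, [ln h >= 1 + ln H - H / h] at every value [h > 0] of the density
   dP/dQ; integrating against P, the last term contributes at most the integral
   of H against Q. *)
Lemma relative_entropy_ge (R : realType) d (T : measurableType d)
    (P Q : probability T R) (g H : T -> R) :
    measurable_fun setT H -> (forall x, 0 < H x) ->
    (\int[Q]_x (H x)%:E <= 1)%E ->
    P.-integrable setT (EFin \o g) -> (forall x, g x <= ln (H x)) ->
  (\int[P]_x (g x)%:E <= relative_entropy P Q)%E.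
Proof.
move=> mH H0 H1 ig gH; rewrite /relative_entropy; case: asboolP => [PQ|_];
  last exact: leey.
have [h [mh h0 hRN hgt0 hint]] := Radon_Nikodym_nonneg_version PQ.
(* This is [H / h], set to 0 where [h] vanishes; the inverse is written as [expR (- ln _)] so that
   measurability follows from that of [expR] and [ln]. *)
pose k x := if 0 < h x then H x * expR (- ln (h x)) else 0.
have k0 x : 0 <= k x.
  by rewrite /k; case: ifP => // _; rewrite mulr_ge0 ?expR_ge0// ltW.
have mk : measurable_fun setT k.
  apply: measurable_fun_ifT => //; first exact: measurable_fun_ltr.
  apply: measurable_funM => //; apply: measurableT_comp => //.
  by apply: measurableT_comp => //; exact: measurableT_comp.
have kE x : 0 < h x -> k x = H x / h x.
  by move=> hx; rewrite /k hx expRN lnK// posrE.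
have k1 : (\int[P]_x (k x)%:E <= 1)%E.
  (* Against Q the integrand [k * h] is [H] where [h > 0] and 0 elsewhere, hence at most [H]. *)
  rewrite hint//; apply: le_trans H1; apply: ge0_le_integral => //.
  - by move=> x _; rewrite lee_fin mulr_ge0.
  - by apply/measurable_EFinP; exact: measurable_funM.
  - exact/measurable_EFinP.
  move=> x _; rewrite lee_fin; have := h0 x; rewrite le_eqVlt => /predU1P[<-|hx].
    by rewrite mulr0 ltW.
  by rewrite kE// divfK// gt_eqF.
have ik : P.-integrable setT (EFin \o k).
  apply/integrableP; split; first exact/measurable_EFinP.
  under eq_integral do rewrite /= ger0_norm//.
  by rewrite (le_lt_trans k1)// ltry.
have i1 : P.-integrable setT (EFin \o cst 1).
  by apply: finite_measure_integrable_cst.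
have mg : measurable_fun setT g by apply/measurable_EFinP; exact: measurable_int ig.
have ik1 : P.-integrable setT (fun x => (1 - k x)%:E).
  by under eq_fun do rewrite EFinB; exact: integrableB.
(* Adding [1 - k], whose P-integral is nonnegative by [k1], turns the claim into the pointwise
   inequality [g + 1 - k <= ln h]. *)
apply: (@le_trans _ _ (\int[P]_x (g x + (1 - k x))%:E)%E).
  under [leRHS]eq_integral do rewrite EFinD.
  rewrite integralD//; rewrite leeDl//.
  under eq_integral do rewrite EFinB.
  rewrite integralB// integral_cst// mul1e [X in (X - _)%E](_ : _ = 1%E).
    by rewrite -[leLHS](@subee _ 1%E)// leeB.
  exact: probability_setT.
apply: (@le_trans _ _ (\int[P]_x (lne (h x)%:E))%E); last first.
  apply: ae_ge_integral.
  - exact: measurable_lne.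
  - have mRN : measurable_fun setT (Radon_Nikodym (charge_of_finite_measure P) Q).
      by apply: measurable_int; exact: Radon_Nikodym_integrable.
    have RNE x : Radon_Nikodym (charge_of_finite_measure P) Q x =
        (fine (Radon_Nikodym (charge_of_finite_measure P) Q x))%:E.
      by rewrite fineK// Radon_Nikodym_fin_num.
    under eq_fun do rewrite RNE.
    by apply: measurable_lne; exact: measurableT_comp.
  by apply: filterS hRN => x ->.
apply: ae_ge_integral.
- by apply/measurable_EFinP; apply: measurable_funD => //; apply: measurable_funB.
- exact: measurable_lne.
apply: filterS hgt0 => x hx.
rewrite lne_EFin// lee_fin kE//.
have := @ln_le_subr1 _ (H x / h x) (divr_gt0 (H0 x) hx).
rewrite ln_div ?posrE// => Hh; have := gH x; lra.
Qed.

(** * Integration under the joint law and under the product of its marginals *)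

Lemma measurable_fun_ord_prod (n : nat) d (T : measurableType d) d'
    (U : measurableType d') (f : 'I_n.+1 * T -> U) :
  (forall i, measurable_fun setT (fun x => f (i, x))) -> measurable_fun setT f.
Proof.
move=> mf _ Y mY; rewrite setTI.
have -> : f @^-1` Y =
    \bigcup_(i in setT) ([set i] `*` ((fun x => f (i, x)) @^-1` Y)).
  apply/seteqP; split => [[i x] /= Yf|[i x] [j _ [/= -> //]]].
  by exists i.
apply: fin_bigcup_measurable; first exact: finite_finset.
move=> i _; apply: measurableX => //.
by rewrite -[X in measurable X]setTI; exact: mf.
Qed.

(** Lets the image of [Q i] under [x |-> (i, x)] be formed as a [distribution]; the joint law is the
    uniform mixture of these images. *)
HB.instance Definition _ (n : nat) d (T : measurableType d) (i : 'I_n.+1) :=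
  isMeasurableFun.Build _ _ T ('I_n.+1 * T)%type (pair i)
    (measurable_pair1 i).

Section uniform_joint_law_integral.
Local Open Scope ereal_scope.
Context (R : realType) d (T : measurableType d) (n : nat).
Variable Q : 'I_n.+1 -> probability T R.
Local Notation J := (uniform_joint_law Q).
Local Notation w := (n.+1%:R^-1 : R)%R.

Let w_ge0 : (0 <= w)%R. Proof. by rewrite invr_ge0. Qed.

Lemma ge0_integral_uniform_joint_law (f : 'I_n.+1 * T -> \bar R) :
    measurable_fun setT f -> (forall z, 0 <= f z) ->
  \int[J]_z f z = \sum_(i < n.+1) w%:E * \int[Q i]_x f (i, x).
Proof.
move=> mf f0.
(* [msum] is indexed by natural numbers, hence [inord]; [inord_val] restores the label. *)
pose mu (k : nat) : {measure set ('I_n.+1 * T) -> \bar R} :=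
  mscale (NngNum w_ge0) (distribution (Q (inord k)) (pair (inord k))).
rewrite (eq_measure_integral (msum mu n.+1)); last first.
  move=> B mB _; rewrite /= /msum /uniform_joint_law; apply: eq_bigr => i _.
  by rewrite /mu /mscale /= inord_val /distribution /pushforward xsectionE.
rewrite ge0_integral_measure_sum//; apply: eq_bigr => i _.
rewrite /mu ge0_integral_mscale// inord_val; congr (_ * _).
by rewrite ge0_integral_distribution.
Qed.

(** Here [j] is the label that generates the observation and [i] an independent uniform label.
    Tonelli gives the double sum, and exchanging the sums puts the average over [i] inside, at fixed
    [x]. *)
Lemma ge0_integral_uniform_marginals (f : 'I_n.+1 * T -> \bar R) :
    measurable_fun setT f -> (forall z, 0 <= f z) ->
  \int[distribution J fst \x distribution J snd]_z f z =
  \sum_(j < n.+1) w%:E * \int[Q j]_x (\sum_(i < n.+1) w%:E * f (i, x)).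
Proof.
move=> mf f0.
have mfi i : measurable_fun setT (fun x => f (i, x)).
  exact: measurableT_comp (measurable_pair1 i).
rewrite fubini_tonelli1// ge0_integral_distribution//; last first.
  by move=> i; exact: integral_ge0.
rewrite ge0_integral_uniform_joint_law//=; last 2 first.
- by apply: measurable_fun_ord_prod => i /=; exact: measurable_cst.
- by move=> z; exact: integral_ge0.
have FE i : fubini_F (distribution J snd) f i =
    \sum_(j < n.+1) w%:E * \int[Q j]_x f (i, x).
  rewrite /fubini_F (ge0_integral_distribution (snd : {mfun _ >-> _}))//.
  rewrite ge0_integral_uniform_joint_law//.
    by apply: measurableT_comp; [exact: mfi|exact: measurable_snd].
  by move=> z /=.
have intFE i : \int[Q i]__ fubini_F (distribution J snd) f i =
    \sum_(j < n.+1) w%:E * \int[Q j]_x f (i, x).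
  rewrite integral_cst// -FE [X in _ * X](_ : _ = 1) ?mule1//.
  exact: probability_setT.
transitivity (\sum_(i < n.+1) \sum_(j < n.+1)
    w%:E * (w%:E * \int[Q j]_x f (i, x))).
  apply: eq_bigr => i _; rewrite -ge0_sume_distrr; last first.
    by move=> j _; rewrite mule_ge0// ?lee_fin// integral_ge0.
  congr (_ * _); exact: intFE.
under [RHS]eq_bigr => j _.
  rewrite ge0_integral_sum//; last 2 first.
  - by move=> i; exact: measurable_funeM.
  - by move=> i x _; rewrite mule_ge0// lee_fin.
  rewrite ge0_sume_distrr//; last first.
    by move=> i _; apply: integral_ge0 => x _; rewrite mule_ge0// lee_fin.
  over.
rewrite exchange_big/=; apply: eq_bigr => j _; apply: eq_bigr => i _.
by rewrite ge0_integralZl// lee_fin.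
Qed.

End uniform_joint_law_integral.

(** * Lower bound on the mutual information *)

(** Jensen's inequality for [ln] at the points [N / 2], [1 / 2] and [1] with weights [q],
    [alpha - q] and [1 - alpha]. *)
Lemma le_ln_fano (R : realType) (N q alpha : R) : 0 < N -> 0 <= q -> q <= alpha ->
    alpha <= 1 -> 0 < 1 - alpha / 2 + (N - 1) / 2 * q ->
  q * ln N - alpha * ln 2 <= ln (1 - alpha / 2 + (N - 1) / 2 * q).
Proof.
set H := 1 - _ + _ => N0 q0 qa a1 H0.
(* The graph of [ln] lies below its tangent at the mean [H]; the weighted sum of the three tangent
   bounds has right-hand side [H / H - 1 = 0]. *)
have lnVle v : 0 < v -> ln v - ln H <= v * H^-1 - 1.
  move=> v0; rewrite -ln_div ?posrE//.
  by apply: ln_le_subr1; rewrite divr_gt0.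
have HV : H * H^-1 = 1 by rewrite divff// gt_eqF.
have N2 : ln N - ln 2 - ln H <= N / 2 * H^-1 - 1.
  by rewrite -ln_div ?posrE//; apply: lnVle; rewrite divr_gt0.
have i2 : - ln 2 - ln H <= 2^-1 * H^-1 - 1.
  by rewrite -lnV ?posrE//; apply: lnVle; rewrite invr_gt0.
have o1 : - ln H <= H^-1 - 1 by have := lnVle 1 ltr01; rewrite ln1 sub0r mul1r.
move: HV N2 i2 o1; move: (ln H) (H^-1) (ln N) (ln 2) => l t lN l2.
rewrite /H => HV N2 i2 o1.
have qa0 : 0 <= alpha - q by rewrite subr_ge0.
have a10 : 0 <= 1 - alpha by rewrite subr_ge0.
have := ler_wpM2l q0 N2; have := ler_wpM2l qa0 i2; have := ler_wpM2l a10 o1.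
lra.
Qed.

Section fano.
Local Open Scope ereal_scope.
Context (R : realType) d (T : measurableType d) (n : nat).
Variables (Q : 'I_n.+1 -> probability T R).
Variables (q : 'I_n.+1 -> T -> R) (alpha : T -> R).
Hypothesis mq : forall i, measurable_fun setT (q i).
Hypothesis malpha : measurable_fun setT alpha.
Hypothesis q_ge0 : forall i x, (0 <= q i x)%R.
Hypothesis sumq_le : forall x, (\sum_(i < n.+1) q i x <= alpha x)%R.
Hypothesis alpha_le1 : forall x, (alpha x <= 1)%R.
Local Notation J := (uniform_joint_law Q).
Local Notation N := (n.+1%:R : R)%R.

Let w_ge0 : (0 <= N^-1)%R. Proof. by rewrite invr_ge0. Qed.

(* Average over the action of the exponential of the test function, whose values
   are N / 2, 1 / 2 and 1 with weights q, alpha - q and 1 - alpha. *)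
Let H (z : 'I_n.+1 * T) : R := (1 - alpha z.2 / 2 + (N - 1) / 2 * q z.1 z.2)%R.

Let q_le i x : (q i x <= alpha x)%R.
Proof.
apply: le_trans (sumq_le x); rewrite (bigD1 i)//= lerDl.
by apply: sumr_ge0 => j _.
Qed.

Let N_ge1 : (1 <= N)%R. Proof. by rewrite ler1n. Qed.

Let H_gt0 z : (0 < H z)%R.
Proof.
have := alpha_le1 z.2; have : (0 <= (N - 1) / 2 * q z.1 z.2)%R.
  by rewrite mulr_ge0// divr_ge0// subr_ge0.
rewrite /H; lra.
Qed.

Let mqz : measurable_fun setT (fun z : 'I_n.+1 * T => q z.1 z.2).
Proof. by apply: measurable_fun_ord_prod => i; exact: mq. Qed.

Let malphaz : measurable_fun setT (fun z : 'I_n.+1 * T => alpha z.2).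
Proof. by apply: measurable_fun_ord_prod => i; exact: malpha. Qed.

Let mH : measurable_fun setT H.
Proof.
apply: measurable_funD; last exact: measurable_funM.
by apply: measurable_funB => //; exact: measurable_funM.
Qed.

Let alpha_ge0 x : (0 <= alpha x)%R.
Proof. exact: le_trans (q_ge0 ord0 x) (q_le ord0 x). Qed.

(** At fixed [x], averaging [q] over an independent uniform label gives at most [alpha / N], so [H]
    averages to at most [1 - alpha / (2 N)]. *)
Let integral_H_le1 :
  \int[distribution J fst \x distribution J snd]_z (H z)%:E <= 1.
Proof.
rewrite ge0_integral_uniform_marginals//; last 2 first.
- exact/measurable_EFinP.
- by move=> z; rewrite lee_fin ltW.
rewrite [leRHS](_ : _ = \sum_(j < n.+1) N^-1%:E * 1); last first.
  under eq_bigr do rewrite mule1.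
  by rewrite sumEFin sumr_const card_ord -[(_^-1 *+ _)%R]mulr_natr mulVf// pnatr_eq0.
apply: lee_sum => j _; apply: lee_wpmul2l; first by rewrite lee_fin.
rewrite -[leRHS](_ : \int[Q j]_x 1 = 1); last first.
  by rewrite integral_cst// mul1e; exact: probability_setT.
apply: ge0_le_integral => //.
- move=> x _; apply: sume_ge0 => i _.
  by rewrite -EFinM lee_fin mulr_ge0// ltW.
- apply: emeasurable_sum => i; apply: measurable_funeM.
  by apply/measurable_EFinP; apply: measurableT_comp => //; exact: measurable_pair1.
move=> x _; under eq_bigr do rewrite -EFinM; rewrite sumEFin lee_fin -mulr_sumr.
rewrite ler_pdivrMl ?(lt_le_trans ltr01)// mulr1 /H /= big_split/= -mulr_sumr.
rewrite sumr_const card_ord -[((1 - _) *+ _)%R]mulr_natr.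
have := sumq_le x; set s := (\sum_(i < _) _)%R => sa.
have : (0 <= (N - 1) * (alpha x - s))%R by rewrite mulr_ge0// subr_ge0.
have := alpha_ge0 x; lra.
Qed.

Lemma mutual_information_uniform_ge :
  (ln N)%:E * (\sum_(i < n.+1) N^-1%:E * \int[Q i]_x (q i x)%:E) -
  (ln 2)%:E * (\sum_(i < n.+1) N^-1%:E * \int[Q i]_x (alpha x)%:E)
  <= mutual_information J.
Proof.
have bounded_integrable (f : 'I_n.+1 * T -> R) : measurable_fun setT f ->
    (forall z, (0 <= f z <= 1)%R) -> J.-integrable setT (EFin \o f).
  move=> mf f01; apply: measurable_bounded_integrable => //.
    by rewrite (le_lt_trans (probability_le1 _ _))// ltry.
  exists 1%R; split => // M M1 z _ /=; have /andP[f0 f1] := f01 z.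
  by rewrite ger0_norm// (le_trans f1)// ltW.
have iq : J.-integrable setT (EFin \o (fun z => q z.1 z.2)).
  by apply: bounded_integrable => // z; rewrite q_ge0 (le_trans (q_le _ _)).
have ia : J.-integrable setT (EFin \o (fun z => alpha z.2)).
  by apply: bounded_integrable => // z; rewrite alpha_ge0 alpha_le1.
have iqN : J.-integrable setT (fun z => (ln N)%:E * (q z.1 z.2)%:E).
  exact: integrableZl iq.
have ia2 : J.-integrable setT (fun z => (ln 2)%:E * (alpha z.2)%:E).
  exact: integrableZl ia.
(* The average over the action of the test function itself, whereas [H] averages its exponential. *)
pose g (z : 'I_n.+1 * T) : R := (q z.1 z.2 * ln N - alpha z.2 * ln 2)%R.
have gE : EFin \o g =
    (fun z => (ln N)%:E * (q z.1 z.2)%:E - (ln 2)%:E * (alpha z.2)%:E).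
  by apply/funext => z; rewrite /= /g EFinB !EFinM ![_ * (ln _)%:E]muleC.
rewrite [leLHS](_ : _ = \int[J]_z (g z)%:E); last first.
  rewrite -[RHS]/(integral J setT (EFin \o g)) gE integralB//.
  rewrite integralZl// integralZl// !ge0_integral_uniform_joint_law//=.
  - exact/measurable_EFinP.
  - by move=> z; rewrite lee_fin.
  - exact/measurable_EFinP.
  - by move=> z; rewrite lee_fin.
apply: (relative_entropy_ge mH H_gt0 integral_H_le1) => [|z].
  by rewrite gE; exact: integrableB.
by apply: le_ln_fano => //; exact: H_gt0.
Qed.

End fano.

(** * Losses and events in the action space *)

(** Integrates the pointwise bound [c * \1_A0 <= l + c * \1_B], with [B] the part of [A0] where
    [l < c]: an action in [A0] outside [B] loses at least [c]. *)
Lemma expected_loss_ge (R : realType) dX dA (X : measurableType dX)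
    (A : measurableType dA) (mu : probability X R) (a : R.-pker X ~> A)
    (l : A -> R) (c : R) (A0 : set A) :
    measurable_fun setT l -> (forall b, 0 <= l b) -> 0 <= c -> measurable A0 ->
  (c%:E * \int[mu]_x a x A0 <=
   \int[mu]_x \int[a x]_b (l b)%:E +
   c%:E * \int[mu]_x a x (A0 `&` [set b | (l b < c)%R]))%E.
Proof.
move=> ml l0 c0 mA0; set B := A0 `&` _.
have mB : measurable B.
  apply: measurableI => //; rewrite -[X in measurable X]setTI.
  have -> : [set b | l b < c] = l @^-1` `]-oo, c[.
    by apply/seteqP; split => b /=; rewrite in_itv.
  exact: ml.
have mker C : measurable C -> measurable_fun setT (fun x => a x C).
  exact: measurable_kernel.
have mint : measurable_fun setT (fun x => \int[a x]_b (l b)%:E)%E.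
  apply: (measurable_fun_integral_kernel mker).
    by move=> b; rewrite lee_fin.
  exact/measurable_EFinP.
have int0 x : (0 <= \int[a x]_b (l b)%:E)%E.
  by apply: integral_ge0 => b _; rewrite lee_fin.
rewrite -!ge0_integralZl//; [|exact: mker..].
rewrite -ge0_integralD//; [|by move=> x _; rewrite mule_ge0|
  by apply: measurable_funeM; exact: mker].
apply: ge0_le_integral => //.
- by move=> x _; rewrite mule_ge0.
- by apply: measurable_funeM; exact: mker.
- by apply: emeasurable_funD => //; apply: measurable_funeM; exact: mker.
move=> x _.
have aE C : measurable C -> (c%:E * a x C = \int[a x]_b (c * \1_C b)%:E)%E.
  move=> mC; under eq_integral do rewrite EFinM.
  rewrite ge0_integralZl// ?integral_indic ?setIT//.
  by apply/measurable_EFinP; exact: measurable_indic.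
have mc (C : set A) : measurable C -> measurable_fun setT (fun b => (c * \1_C b)%:E).
  move=> mC; apply/measurable_EFinP; exact: measurable_funM.
have c1 (C : set A) b : (0 <= (c * \1_C b)%:E)%E by rewrite lee_fin mulr_ge0.
rewrite !aE// -ge0_integralD//; [|by move=> b _; rewrite lee_fin|
  exact/measurable_EFinP|exact: mc].
apply: ge0_le_integral => //; first exact: mc.
  by apply: emeasurable_funD; [exact/measurable_EFinP|exact: mc].
move=> b _; rewrite -EFinD lee_fin !indicE.
have [bA0|] := boolP (b \in A0); last by rewrite mulr0 => _; rewrite addr_ge0// mulr_ge0.
rewrite mulr1; have [bB|] := boolP (b \in B); first by rewrite mulr1 lerDr.
rewrite mulr0 addr0; apply: contraR; rewrite -ltNge => lc.
by rewrite inE; split => //; rewrite inE in bA0.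
Qed.

Lemma sum_measure_disjoint_le (R : realType) d (T : measurableType d)
    (mu : {measure set T -> \bar R}) n (B : 'I_n -> set T) (A : set T) :
    measurable A -> (forall i, measurable (B i)) -> trivIset setT B ->
    (forall i, B i `<=` A) ->
  (\sum_(i < n) mu (B i) <= mu A)%E.
Proof.
move=> mA mB tB BA.
have mU : measurable (\big[setU/set0]_(i < n) B i).
  by apply: bigsetU_measurable.
rewrite -measure_semi_additive_ord//; apply: le_measure; rewrite ?inE//.
by apply: (big_ind (fun C => C `<=` A)) => // C D CA DA x [/CA|/DA].
Qed.

(** * Combination of the risk and information bounds *)

(** Eliminating [s] bounds [S] below by [Delta / 2 * (r - (I + r * ln 2) / ln N)]. This is
    nondecreasing in [r] since [ln 2 <= ln N], so [r] may be lowered to [p]. *)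
Lemma fano_arith (R : realType) (N Delta p I r s S : R) :
    2 <= N -> 0 < Delta -> p <= r -> ln N * s - ln 2 * r <= I ->
    Delta / 2 * r <= S + Delta / 2 * s ->
  Delta / 2 * (p - (I + p * ln 2) / ln N) <= S.
Proof.
move=> N2 D0 pr Is Ss.
have l2 : 0 < ln 2 :> R by rewrite ln_gt0// ltr1n.
have lN : ln 2 <= ln N by rewrite ler_ln ?posrE// (lt_le_trans _ N2).
have lN0 : 0 < ln N by exact: lt_le_trans lN.
apply: (@le_trans _ _ (Delta / 2 * (r - s))); last by rewrite mulrBr lerBlDr.
rewrite ler_pM2l ?divr_gt0// lerBlDr -lerBlDl ler_pdivlMr//.
have : 0 <= (r - p) * (ln N - ln 2) by rewrite mulr_ge0 ?subr_ge0.
lra.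
Qed.

Theorem lemma1 (R : realType) (dX dA : measure_display)
    (X : measurableType dX) (A : measurableType dA)
    (Theta : Type) (P : Theta -> probability X R)
    (calL : set (Theta -> A -> R)) (calL_loss : forall L, calL L -> is_loss L)
    (m : nat) (theta : 'I_m.+2 -> Theta) (L_ : 'I_m.+2 -> Theta -> A -> R)
    (L_calL : forall i, calL (L_ i))
    (A0 : set A) (mA0 : measurable A0)
    (Delta : R) (Delta_gt0 : 0 < Delta)
    (sep : forall i j, i != j ->
      (Delta%:E <=
       ereal_inf [set (L_ i (theta i) b + L_ j (theta j) b)%:E | b in A0])%E)
    (a : R.-pker X ~> A)
    (pmin : R) (pmin_gt0 : 0 < pmin)
    (a_A0 : forall i, (pmin%:E <= action_prob P a (theta i) A0)%E) :
  ((Delta / 2)%:E *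
     (pmin%:E -
        (mutual_information (uniform_joint_law (fun i => P (theta i))) +
         (pmin * ln 2)%:E) / (ln m.+2%:R)%:E)
   <= ereal_sup [set ereal_sup [set risk P a L t | L in calL]
                | t in [set: Theta]])%E.
Proof.
set Q := fun i => P (theta i).
set S := ereal_sup _.
pose N : R := m.+2%:R.
pose B i := A0 `&` [set b | L_ i (theta i) b < Delta / 2].
pose q i x := fine (a x (B i)).
pose alpha x := fine (a x A0).
have N2 : 2 <= N by rewrite ler_nat.
have mL i : measurable_fun setT (L_ i (theta i)) by case: (calL_loss _ (L_calL i)).
have L0 i b : 0 <= L_ i (theta i) b by case: (calL_loss _ (L_calL i)).
have mB i : measurable (B i).
  apply: measurableI => //; rewrite -[X in measurable X]setTI.
  have -> : [set b | L_ i (theta i) b < Delta / 2] =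
      L_ i (theta i) @^-1` `]-oo, Delta / 2[.
    by apply/seteqP; split => b /=; rewrite in_itv.
  exact: mL.
have tB : trivIset setT B.
  (* A common action would have two losses below [Delta / 2], with sum below [Delta]. *)
  apply/trivIsetP => i j _ _ ij; apply/seteqP; split => // b [[bA0 /= bi] [_ /= bj]].
  have := le_trans (sep _ _ ij) (ereal_inf_lbound (ex_intro2 _ _ b bA0 erefl)).
  by rewrite lee_fin; lra.
have a1 x C : measurable C -> (a x C <= 1)%E.
  by move=> mC; rewrite -(@prob_kernel _ _ _ _ _ a x); apply: le_measure; rewrite ?inE.
have afin x C : measurable C -> a x C \is a fin_num.
  by move=> mC; rewrite ge0_fin_numE// (le_lt_trans (a1 x C mC))// ltry.
have mfine C : measurable C -> measurable_fun setT (fun x => fine (a x C)).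
  by move=> mC; apply: measurableT_comp => //; exact: measurable_kernel.
have qE i x : (q i x)%:E = a x (B i) by rewrite fineK// afin.
have alphaE x : (alpha x)%:E = a x A0 by rewrite fineK// afin.
have sumq x : \sum_(i < m.+2) q i x <= alpha x.
  rewrite -lee_fin -sumEFin alphaE; under eq_bigr do rewrite qE.
  by apply: sum_measure_disjoint_le => // i; exact: subIsetl.
have intfin i C : measurable C -> (\int[Q i]_x a x C)%E \is a fin_num.
  move=> mC; rewrite ge0_fin_numE ?integral_ge0//.
  apply: (@le_lt_trans _ _ (\int[Q i]_x 1)%E).
    apply: ge0_le_integral => //; first exact: measurable_kernel.
    by move=> x _; exact: a1.
  by rewrite integral_cst// mul1e (le_lt_trans (probability_le1 _ _))// ltry.
pose s := \sum_(i < m.+2) N^-1 * fine (\int[Q i]_x a x (B i)).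
pose r := \sum_(i < m.+2) N^-1 * fine (\int[Q i]_x a x A0).
have rE : (\sum_(i < m.+2) N^-1%:E * \int[Q i]_x a x A0 = r%:E)%E.
  by rewrite /r -sumEFin; apply: eq_bigr => i _; rewrite EFinM fineK// intfin.
have sE : (\sum_(i < m.+2) N^-1%:E * \int[Q i]_x a x (B i) = s%:E)%E.
  by rewrite /s -sumEFin; apply: eq_bigr => i _; rewrite EFinM fineK// intfin.
have N0 : 0 < N by rewrite (lt_le_trans _ N2).
have avg (c : R) : \sum_(i < m.+2) N^-1 * c = c.
  by rewrite sumr_const card_ord -mulrnAl -[N^-1 *+ _]mulr_natr mulVf ?mul1r// gt_eqF.
have pr : pmin <= r.
  rewrite -(avg pmin); apply: ler_sum => i _; rewrite ler_pM2l ?invr_gt0//.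
  by rewrite -lee_fin fineK ?intfin// a_A0.
have SI i : (\int[Q i]_x \int[a x]_b (L_ i (theta i) b)%:E <= S)%E.
  apply: (@le_trans _ _ (ereal_sup [set risk P a L (theta i) | L in calL])).
    by apply: ereal_sup_ubound; exists (L_ i).
  by apply: ereal_sup_ubound; exists (theta i).
have IE : ((ln N * s - ln 2 * r)%:E <= mutual_information (uniform_joint_law Q))%E.
  have := @mutual_information_uniform_ge _ _ _ _ Q q alpha _ _ _ sumq _.
  under eq_bigr do under eq_integral do rewrite qE.
  under [X in (_ - _ * X)%E]eq_bigr do under eq_integral do rewrite alphaE.
  rewrite sE rE EFinB !EFinM; apply => [i||i x|x]; first exact: mfine.
  - exact: mfine.
  - by rewrite -lee_fin qE.
  - by rewrite -lee_fin alphaE a1.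
have : (0 <= S)%E.
  apply: le_trans (SI ord0); apply: integral_ge0 => x _.
  by apply: integral_ge0 => b _; rewrite lee_fin.
(* Nonnegativity excludes [S = -oo], and [S = +oo] is immediate; from here on [S] is real. *)
move: SI IE; case: S => [S| |]// SI IE _; last exact: leey.
have SrS : Delta / 2 * r <= S + Delta / 2 * s.
  rewrite -(avg S) !mulr_sumr -big_split/=; apply: ler_sum => i _.
  (* After cancelling the weight [N^-1], each label is handled by [expected_loss_ge] with
     [c = Delta / 2]. *)
  rewrite mulrCA [Delta / 2 * (_ * _)]mulrCA -mulrDr ler_pM2l ?invr_gt0//.
  rewrite -lee_fin EFinD !EFinM !fineK ?intfin//.
  apply: le_trans (expected_loss_ge (Q i) a (mL i) (L0 i) _ mA0) _.
    by rewrite divr_ge0// ltW.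
  by apply: leeD => //; exact: SI.
have lN0 : 0 < ln N by rewrite ln_gt0// (lt_le_trans _ N2)// ltr1n.
move: IE; case: (mutual_information _) => [I| |]// IE.
  rewrite lee_fin in IE.
  rewrite -EFinD inver gt_eqF// -EFinM lee_fin.
  exact: fano_arith IE SrS.
(* Infinite information sends the left-hand side to [-oo]; the value [-oo] was already excluded by
   [IE]. *)
rewrite addye// inver gt_eqF// gt0_mulye ?lte_fin ?invr_gt0//.
by rewrite addeNy gt0_muleNy ?lte_fin ?divr_gt0// leNye.
Qed.
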